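(* If $\mathbf{Y}_1\sim\mathcal{MMN}_p(\boldsymbol{\xi},\mathbf{\Omega},\boldsymbol{\delta};H)$ and $\mathbf{Y}_2\sim\mathcal{N}_p(\boldsymbol{\mu},\mathbf{\Sigma})$ are independent, then $\mathbf{Y}=\mathbf{Y}_1+\mathbf{Y}_2\sim\mathcal{MMN}_p(\boldsymbol{\xi}_{\mathbf{Y}},\mathbf{\Omega}_{\mathbf{Y}},\boldsymbol{\delta}_{\mathbf{Y}};H)$, where $\boldsymbol{\xi}_{\mathbf{Y}}=\boldsymbol{\xi}+\boldsymbol{\mu}$, $\mathbf{\Omega}_{\mathbf{Y}}=\mathbf{\Omega}+\mathbf{\Sigma}$, and $\boldsymbol{\delta}_{\mathbf{Y}}=\boldsymbol{\omega}_{\mathbf{Y}}^{-1}\boldsymbol{\omega}\boldsymbol{\delta}$, with $\boldsymbol{\omega}_{\mathbf{Y}}=(\mathbf{\Omega}_{\mathbf{Y}}\odot\mathbf{I}_p)^{1/2}$.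
   Context: Let $p\ge1$, $\boldsymbol{\xi}\in\mathbb{R}^p$, $\mathbf{\Omega}$ a $p\times p$ symmetric positive definite matrix, $\boldsymbol{\omega}=(\mathbf{\Omega}\odot\mathbf{I}_p)^{1/2}=\mathrm{diag}(\mathbf{\Omega}_{11}^{1/2},\dots,\mathbf{\Omega}_{pp}^{1/2})$ ($\odot$ is the entrywise/Hadamard product), $\overline{\mathbf{\Omega}}=\boldsymbol{\omega}^{-1}\mathbf{\Omega}\boldsymbol{\omega}^{-1}$, and $\boldsymbol{\delta}\in\mathbb{R}^p$ with $\overline{\mathbf{\Omega}}-\boldsymbol{\delta}\boldsymbol{\delta}^\top$ positive definite. For a real random variable $U$ with CDF $H$ and $\mathbf{Z}\sim\mathcal{N}_p(\mathbf{0},\overline{\mathbf{\Omega}}-\boldsymbol{\delta}\boldsymbol{\delta}^\top)$ independent of $U$, $\boldsymbol{\xi}+\boldsymbol{\omega}(\boldsymbol{\delta}U+\mathbf{Z})$ is said to have distribution $\mathcal{MMN}_p(\boldsymbol{\xi},\mathbf{\Omega},\boldsymbol{\delta};H)$. $\boldsymbol{\mu}\in\mathbb{R}^p$ and $\mathbf{\Sigma}$ is a $p\times p$ covariance matrix. *)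

(* Defs.v *)
From HB Require Import structures.
From mathcomp Require Import all_boot all_order all_algebra.
From mathcomp Require Import all_classical all_reals all_analysis.
Set Implicit Arguments. Unset Strict Implicit. Unset Printing Implicit Defensive.
Import Order.TTheory GRing.Theory Num.Theory.
Local Open Scope classical_set_scope.
Local Open Scope ring_scope.

Section defs.
Variable R : realType.

(* The Borel sigma-algebra on R^p (column vectors), generated by the
   coordinate maps: the product sigma-algebra = Borel sets of R^p. *)
Definition vec_measurable (p : nat) : set (set 'cV[R]_p) :=
  smallest (sigma_algebra setT)
    [set A | exists (i : 'I_p) (B : set R),
               measurable B /\ A = (fun x : 'cV[R]_p => x i 0) @^-1` B].

Definition random_vec d (T : measurableType d) (p : nat) (X : T -> 'cV[R]_p) :=
  forall i : 'I_p, measurable_fun setT (fun t => X t i 0).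

Definition same_law d (T : measurableType d) (P : probability T R)
  d' (T' : measurableType d') (P' : probability T' R) (p : nat)
  (X : T -> 'cV[R]_p) (X' : T' -> 'cV[R]_p) :=
  forall A, vec_measurable A -> P (X @^-1` A) = P' (X' @^-1` A).

Definition normal_law (m v : R) (B : set R) : \bar R :=
  if v == 0 then \d_m B else normal_prob m (Num.sqrt v) B.

Definition is_normal d (T : measurableType d) (P : probability T R) (p : nat)
  (X : T -> 'cV[R]_p) (mu : 'cV[R]_p) (Sigma : 'M[R]_p) :=
  random_vec X /\
  forall (a : 'cV[R]_p) (B : set R), measurable B ->
    P ((fun t => (a^T *m X t) 0 0) @^-1` B)
    = normal_law ((a^T *m mu) 0 0) ((a^T *m Sigma *m a) 0 0) B.

Definition has_cdf d (T : measurableType d) (P : probability T R)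
  (U : T -> R) (H : R -> R) :=
  measurable_fun setT U /\ forall x : R, P (U @^-1` `]-oo, x]) = (H x)%:E.

Definition indep_rv_vec d (T : measurableType d) (P : probability T R) (p : nat)
  (U : T -> R) (Z : T -> 'cV[R]_p) :=
  forall (B : set R) (A : set 'cV[R]_p), measurable B -> vec_measurable A ->
    P (U @^-1` B `&` Z @^-1` A) = (P (U @^-1` B) * P (Z @^-1` A))%E.

Definition indep_vec d (T : measurableType d) (P : probability T R) (p : nat)
  (X Y : T -> 'cV[R]_p) :=
  forall (A B : set 'cV[R]_p), vec_measurable A -> vec_measurable B ->
    P (X @^-1` A `&` Y @^-1` B) = (P (X @^-1` A) * P (Y @^-1` B))%E.

Definition hadamard (p : nat) (A B : 'M[R]_p) : 'M[R]_p :=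
  \matrix_(i, j) (A i j * B i j).

(* omega = (Omega (.) I_p)^{1/2} = diag(Omega_11^{1/2}, ..., Omega_pp^{1/2}):
   the square root of the diagonal matrix Omega (.) I_p, taken entrywise
   on its diagonal. *)
Definition omega_of (p : nat) (Om : 'M[R]_p) : 'M[R]_p :=
  diag_mx (\row_i Num.sqrt (hadamard Om 1%:M i i)).

Definition Omega_bar (p : nat) (Om : 'M[R]_p) : 'M[R]_p :=
  invmx (omega_of Om) *m Om *m invmx (omega_of Om).

Definition sym_posdef (p : nat) (A : 'M[R]_p) :=
  A^T = A /\ forall x : 'cV[R]_p, x != 0 -> 0 < (x^T *m A *m x) 0 0.

Definition covariance_mx (p : nat) (A : 'M[R]_p) :=
  A^T = A /\ forall x : 'cV[R]_p, 0 <= (x^T *m A *m x) 0 0.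

Definition is_MMN d (T : measurableType d) (P : probability T R) (p : nat)
  (Y : T -> 'cV[R]_p) (xi : 'cV[R]_p) (Om : 'M[R]_p) (delta : 'cV[R]_p)
  (H : R -> R) :=
  [/\ sym_posdef Om, sym_posdef (Omega_bar Om - delta *m delta^T),
      random_vec Y &
  exists (d' : measure_display) (T' : measurableType d')
         (P' : probability T' R) (U : T' -> R) (Z : T' -> 'cV[R]_p),
    [/\ has_cdf P' U H, is_normal P' Z 0 (Omega_bar Om - delta *m delta^T),
        indep_rv_vec P' U Z &
        same_law P P' Y (fun t => xi + omega_of Om *m (U t *: delta + Z t))]].

End defs.

(* Main.v *)
Require Import Defs.
From HB Require Import structures.
From mathcomp Require Import all_boot all_order all_algebra.
From mathcomp Require Import all_classical all_reals all_analysis.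
From mathcomp Require Import measurable_realfun ring.
Import Order.TTheory GRing.Theory Num.Theory.
Local Open Scope classical_set_scope.
Local Open Scope ring_scope.

(** Let [W] be the diagonal scale matrix of [Om + Sigma] and [w] that of [Om].
    If [Y1] has the law of [xi + w (U delta + Z)] for [U], [Z] living on [T'],
    then on the product space [T * T'] the variable [U] and the vector
    [W^-1 (w Z + Y2 - mu)] represent [Y1 + Y2]: by Fubini they are independent,
    since [U] and [Z] are independent for each fixed value of [Y2].  Normality
    of the new vector only concerns its linear functionals, so it reduces to the
    convolution of two (possibly degenerate) normal laws on the line, which is
    computed by completing the square in the product of the densities.  The
    joint law of [(Y1, Y2)] is the product of its marginals by uniqueness of
    product measures, hence replacing [Y1] by its representation on [T'] keeps
    the law of the sum. *)

(** * Positive definite matrices and diagonal rescaling *)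

Section posdef.
Context {R : realType} {p : nat}.
Implicit Types (A B S M : 'M[R]_p) (x y : 'cV[R]_p).

Lemma sym_posdefD_cov A S : sym_posdef A -> covariance_mx S -> sym_posdef (A + S).
Proof.
move=> [symA posA] [symS posS]; split; first by rewrite linearD/= symA symS.
by move=> x x0; rewrite mulmxDr mulmxDl mxE ltr_wpDr ?posA.
Qed.

(** The form at [x] is that of [A] at [M *m x], which is nonzero because [M] is invertible. *)
Lemma sym_posdef_congr A M : M \in unitmx -> sym_posdef A -> sym_posdef (M^T *m A *m M).
Proof.
move=> uM [symA posA]; split; first by rewrite !trmx_mul trmxK symA mulmxA.
move=> x x0; rewrite !mulmxA -trmx_mul -2!mulmxA mulmxA posA//.
by apply: contraNneq x0 => Mx0; rewrite -(mulKmx uM x) Mx0 mulmx0.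
Qed.

Lemma sym_posdef_psd A x : sym_posdef A -> 0 <= (x^T *m A *m x) 0 0.
Proof.
move=> [_ posA]; have [->|/posA/ltW//] := eqVneq x 0.
by rewrite mulmx0 mxE.
Qed.

Lemma sym_posdef_diag_gt0 A i : sym_posdef A -> 0 < A i i.
Proof.
move=> [_ /(_ (delta_mx i 0))]; rewrite trmx_delta -rowE -colE !mxE; apply.
apply/eqP => /matrixP/(_ i 0)/eqP; rewrite !mxE !eqxx/=.
by rewrite oner_eq0.
Qed.

Lemma tr_omega_of A : (omega_of A)^T = omega_of A.
Proof. exact: tr_diag_mx. Qed.

(** The determinant is the product of the square roots of the diagonal entries, each positive as a
    value of the quadratic form at a basis vector. *)
Lemma omega_of_unit A : sym_posdef A -> omega_of A \in unitmx.
Proof.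
move=> posA; rewrite unitmxE det_diag unitfE; apply/prodf_neq0 => i _.
by rewrite !mxE eqxx mulr1 gt_eqF// sqrtr_gt0 sym_posdef_diag_gt0.
Qed.

Lemma omega_ofK A : sym_posdef A -> omega_of A *m Omega_bar A *m omega_of A = A.
Proof.
by move=> /omega_of_unit uA; rewrite /Omega_bar !mulmxA mulmxV// mul1mx mulmxKV.
Qed.

(** Writing [w] for [omega_of A], one has [W *m y = w *m x] and [w *m Omega_bar A *m w = A], so both
    sides equal the conjugate by the inverse of [W] of [A + S] minus the rank-one matrix of
    [w *m x]. The right-hand form serves twice: it shows positive definiteness, and it is the
    covariance of the new Gaussian part. *)
Lemma Omega_barD_sub A S x : sym_posdef A -> covariance_mx S ->
  let W := omega_of (A + S) in
  let y := invmx W *m omega_of A *m x in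
  Omega_bar (A + S) - y *m y^T =
  (invmx W)^T *m (omega_of A *m (Omega_bar A - x *m x^T) *m omega_of A + S) *m invmx W.
Proof.
move=> posA covS /=; set W := omega_of (A + S); set y := _ *m x.
have -> : omega_of A *m (Omega_bar A - x *m x^T) *m omega_of A + S =
    A + S - (omega_of A *m x) *m (omega_of A *m x)^T.
  rewrite mulmxBr mulmxBl omega_ofK// trmx_mul tr_omega_of !mulmxA.
  by rewrite addrAC.
have -> : y = invmx W *m (omega_of A *m x) by rewrite mulmxA.
rewrite trmx_mul mulmxBr mulmxBl !mulmxA.
by rewrite trmx_inv tr_omega_of.
Qed.

Lemma sym_posdef_MMN_add A S x : sym_posdef A -> covariance_mx S ->
  sym_posdef (Omega_bar A - x *m x^T) ->
  let y := invmx (omega_of (A + S)) *m omega_of A *m x in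
  sym_posdef (Omega_bar (A + S) - y *m y^T).
Proof.
move=> posA covS posB /=; rewrite Omega_barD_sub//.
apply: sym_posdef_congr.
  by rewrite unitmx_inv omega_of_unit//; exact: sym_posdefD_cov.
apply: sym_posdefD_cov => //; rewrite -{1}tr_omega_of.
by apply: sym_posdef_congr => //; exact: omega_of_unit.
Qed.

End posdef.

(** * Convolution of nondegenerate normal laws on the line *)

Section gaussian_convolution.
Context {R : realType}.
Local Notation mR := (measurableTypeR R).
Local Notation mu := (@lebesgue_measure R).
Implicit Types (m s c : R) (B : set mR).

Lemma measurable_addr c : measurable_fun setT (fun x : mR => x + c : mR).
Proof. by apply: measurable_funD => //; exact: measurable_cst. Qed.

(** The pushforward agrees with Lebesgue measure on half-open intervals, which determine it. *)
Lemma lebesgue_measure_shift c B : measurable B ->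
  pushforward mu (fun x : mR => x + c : mR) B = mu B.
Proof.
move=> mB; have mc := measurable_addr c.
pose sh : {mfun mR >-> mR} := HB.pack (fun x : mR => x + c : mR)
  (isMeasurableFun.Build _ _ _ _ _ mc).
apply/esym/(@lebesgue_measure_unique _ (pushforward mu sh)) => //= _ [[a b]] _ <-.
rewrite /pushforward/=.
rewrite (_ : _ @^-1` _ = `](a - c), (b - c)]%classic); last first.
  by apply/seteqP; split => x /=; rewrite !in_itv/= ltrBlDr lerBrDr.
rewrite !lebesgue_measure_itv/= !lte_fin ltrD2r.
by case: ifP => // _; rewrite -!EFinD; congr (_%:E); ring.
Qed.

Lemma ge0_integral_shift (f : mR -> \bar R) c :
  measurable_fun setT f -> (forall x, 0 <= f x)%E ->
  (\int[mu]_x f (x + c)%R = \int[mu]_x f x)%E.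
Proof.
move=> mf f0.
have := @ge0_integral_pushforward _ _ _ _ _ _ (measurable_addr c) mu setT f
  measurableT mf (fun y _ => f0 y).
rewrite preimage_setT => <-; apply: eq_measure_integral => [|? A mA _].
  exact: measurable_addr.
exact: lebesgue_measure_shift.
Qed.

Lemma normal_pdf_shift m c s x : s != 0 ->
  normal_pdf (m + c) s (x + c) = normal_pdf m s x.
Proof.
by move=> s0; rewrite !normal_pdfE//= /normal_fun opprD addrACA subrr addr0.
Qed.

Lemma normal_prob_shift m c s B : s != 0 -> measurable B ->
  normal_prob m s ((fun x : mR => x + c : mR) @^-1` B) = normal_prob (m + c) s B.
Proof.
move=> s0 mB; rewrite /normal_prob integral_mkcond [RHS]integral_mkcond.
rewrite -[RHS](ge0_integral_shift _ c).
- by apply: eq_integral => x _; rewrite !patchE/= normal_pdf_shift.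
- apply/measurable_restrict => //; rewrite setTI; apply: measurable_funTS.
  by apply/measurable_EFinP; exact: measurable_normal_pdf.
- by move=> x; rewrite patchE; case: ifP => // _; rewrite lee_fin normal_pdf_ge0.
Qed.

(** The Radon-Nikodym derivative is almost everywhere the normal density, since both have the same
    integral over every measurable set. *)
Lemma integral_normal_prob m s (f : mR -> \bar R) :
  (normal_prob m s).-integrable setT f ->
  (\int[normal_prob m s]_x f x = \int[mu]_x (f x * (normal_pdf m s x)%:E))%E.
Proof.
move=> fi; have /measurable_int mf := fi.
have dom := normal_prob_dominates m s.
have mpdf : measurable_fun setT (fun x : mR => (normal_pdf m s x)%:E).
  by apply/measurable_EFinP; exact: measurable_normal_pdf.
rewrite -(Radon_Nikodym_change_of_variables dom)//=.
apply: ae_eq_integral => //.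
- apply: emeasurable_funM => //; exact: (measurable_int mu).
- exact: emeasurable_funM.
- apply: ae_eqe_mul2l => /=.
  rewrite Radon_NikodymE//=; case: cid => /= h [h1 h2 h3].
  by apply: integral_ae_eq => //= E _ mE; rewrite -h3.
Qed.

(** A peak is the inverse square root of 2 pi times the variance, so a product of two peaks depends
    only on the product of the variances. *)
Lemma normal_peakM (s1 s2 s3 s4 : R) : s1 ^+ 2 * s2 ^+ 2 = s3 ^+ 2 * s4 ^+ 2 ->
  normal_peak s1 * normal_peak s2 = normal_peak s3 * normal_peak s4.
Proof.
move=> ss; rewrite /normal_peak -!invfM; congr (_^-1).
have ge0 s : 0 <= s ^+ 2 * pi *+ 2 :> R.
  by rewrite mulrn_wge0// mulr_ge0 ?sqr_ge0 ?pi_ge0.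
rewrite -!sqrtrM//; congr (Num.sqrt _).
have pull (a b : R) : a * pi *+ 2 * (b * pi *+ 2) = (a * b) * (pi *+ 2) ^+ 2.
  ring.
by rewrite !pull ss.
Qed.

(* Completing the square in [w]. *)
Lemma normal_pdfM m1 m2 (s1 s2 s y w : R) : s1 != 0 -> s2 != 0 -> s != 0 ->
  s ^+ 2 = s1 ^+ 2 + s2 ^+ 2 ->
  normal_pdf (m1 + w) s1 y * normal_pdf m2 s2 w =
  normal_pdf (m1 + m2) s y *
  normal_pdf ((s2 ^+ 2 * (y - m1) + s1 ^+ 2 * m2) / s ^+ 2) (s1 * s2 / s) w.
Proof.
move=> s10 s20 s0 sE.
have t0 : s1 * s2 / s != 0 by rewrite !mulf_neq0 ?invr_eq0.
have s120 : s1 ^+ 2 + s2 ^+ 2 != 0 by rewrite -sE expf_neq0.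
rewrite !normal_pdfE//= mulrACA [RHS]mulrACA; congr (_ * _).
  by apply: normal_peakM; field.
rewrite /normal_fun -!expRD; congr expR.
rewrite !exprMn exprVn sE; field.
by rewrite s120 s10 s20.
Qed.

Lemma normal_prob_le1 m s B : measurable B -> (normal_prob m s B <= 1)%E.
Proof. by move=> mB; exact: probability_le1. Qed.

Lemma measurable_add_pair : measurable_fun setT (fun wx : mR * mR => wx.1 + wx.2 : mR).
Proof. by apply: measurable_funD; [exact: measurable_fst|exact: measurable_snd]. Qed.

Lemma measurable_add_preimage B : measurable B ->
  measurable ((fun wx : mR * mR => wx.1 + wx.2 : mR) @^-1` B).
Proof. by move=> mB; rewrite -[X in measurable X]setTI; exact: measurable_add_pair. Qed.

Lemma xsection_add_preimage B (w : mR) :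
  xsection ((fun wx : mR * mR => wx.1 + wx.2 : mR) @^-1` B) w =
  (fun x : mR => x + w : mR) @^-1` B.
Proof. by apply/seteqP; split => x /=; rewrite xsectionE /= addrC. Qed.

(** After Tonelli and completion of the square, the inner integrand is the density of the sum at [y]
    times a normal density in [w], and the latter integrates to 1. *)
Lemma normal_convolution m1 m2 (s1 s2 s : R) B : s1 != 0 -> s2 != 0 -> s != 0 ->
  s ^+ 2 = s1 ^+ 2 + s2 ^+ 2 -> measurable B ->
  (normal_prob m2 s2 \x normal_prob m1 s1)%E
    ((fun wx : mR * mR => wx.1 + wx.2 : mR) @^-1` B) = normal_prob (m1 + m2) s B.
Proof.
move=> s10 s20 s0 sE mB.
have mS := measurable_add_preimage _ mB.
rewrite /product_measure1.
have secE w : normal_prob m1 s1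
    (xsection ((fun wx : mR * mR => wx.1 + wx.2 : mR) @^-1` B) w) =
    normal_prob (m1 + w) s1 B.
  by rewrite xsection_add_preimage normal_prob_shift.
(* Passing to densities requires integrability, which holds because the measure of each section is
   at most 1. *)
rewrite integral_normal_prob; last first.
  apply/integrableP; split; first exact: measurable_fun_xsection.
  apply: (@le_lt_trans _ _ (\int[normal_prob m2 s2]_x (cst 1 x))%E); last first.
    by rewrite integral_cst// mul1e (le_lt_trans (normal_prob_le1 _ _ _ measurableT))// ltry.
  apply: ge0_le_integral => //=.
  - by apply: measurableT_comp => //; exact: measurable_fun_xsection.
  - by move=> w _; rewrite secE gee0_abs// normal_prob_le1.
(* The joint density of the first summand [w] and the sum [y], cut off to [B]. Writing it with
   [y - w] makes joint measurability immediate; [pdf_sub] then moves [w] into the mean. *)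
pose F (wy : mR * mR) : \bar R :=
  ((\1_B wy.2 * (normal_pdf m1 s1 (wy.2 - wy.1) * normal_pdf m2 s2 wy.1)))%:E.
have pdf_sub w y : normal_pdf m1 s1 (y - w) = normal_pdf (m1 + w) s1 y.
  by rewrite -(normal_pdf_shift m1 w)// subrK.
have mF : measurable_fun setT F.
  apply/measurable_EFinP; apply: measurable_funM.
    by apply: measurableT_comp => //; exact: measurable_indic.
  apply: measurable_funM; last first.
    by apply: measurableT_comp; [exact: measurable_normal_pdf|].
  apply: (measurableT_comp (measurable_normal_pdf _ _)).
  by apply: measurable_funB; [exact: measurable_snd|exact: measurable_fst].
have F0 wy : (0 <= F wy)%E by rewrite lee_fin !mulr_ge0 ?normal_pdf_ge0.
transitivity (\int[mu]_w \int[mu]_y F (w, y))%E.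
  apply: eq_integral => w _; rewrite /= secE /normal_prob integral_mkcond.
  rewrite -ge0_integralZr//=.
  - apply: eq_integral => y _; rewrite patchE /F/= pdf_sub indicE.
    by case: ifP => _; rewrite ?mul0e ?mul0r// mul1r.
  - apply/measurable_restrict => //; rewrite setTI; apply: measurable_funTS.
    by apply/measurable_EFinP; exact: measurable_normal_pdf.
  - by move=> x _; rewrite patchE; case: ifP => // _; rewrite lee_fin normal_pdf_ge0.
  - by rewrite lee_fin normal_pdf_ge0.
rewrite (@fubini_tonelli _ _ _ _ _ mu mu F)//.
rewrite /normal_prob [RHS]integral_mkcond; apply: eq_integral => y _.
under eq_integral.
  move=> w _; rewrite /F/= pdf_sub (@normal_pdfM _ _ _ _ s)// mulrA EFinM.
  over.
rewrite ge0_integralZl//=.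
- rewrite integral_normal_pdf mule1 patchE indicE.
  by case: ifP => _; rewrite ?mul1r ?mul0r.
- by apply/measurable_EFinP; exact: measurable_normal_pdf.
- by move=> w _; rewrite lee_fin normal_pdf_ge0.
- by rewrite lee_fin mulr_ge0 ?normal_pdf_ge0.
Qed.

End gaussian_convolution.

(** * Image laws of product measures and joint laws of independent variables *)

Section product_laws.
Context {R : realType} {d1 d2 e1 e2 : measure_display}.
Context {T1 : measurableType d1} {T2 : measurableType d2}.
Context {E1 : measurableType e1} {E2 : measurableType e2}.
Local Open Scope ereal_scope.

(** The section at [x] of the preimage of [S] is the preimage under [f2] of the section of [S] at
    [f1 x]; a change of variables along [f1] then finishes the computation. *)
Lemma product_measure1_law (P1 : probability T1 R) (P2 : probability T2 R)
    (Q1 : probability E1 R) (Q2 : probability E2 R) (f1 : T1 -> E1) (f2 : T2 -> E2) :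
  measurable_fun setT f1 ->
  (forall A, measurable A -> P1 (f1 @^-1` A) = Q1 A) ->
  (forall A, measurable A -> P2 (f2 @^-1` A) = Q2 A) ->
  forall S, measurable S ->
    (P1 \x P2) ((fun t => (f1 t.1, f2 t.2)) @^-1` S) = (Q1 \x Q2) S.
Proof.
move=> mf1 law1 law2 S mS; rewrite /product_measure1/=.
transitivity (\int[P1]_(x in f1 @^-1` setT) ((Q2 \o xsection S) \o f1) x).
  rewrite preimage_setT; apply: eq_integral => x _ /=.
  rewrite -law2; last exact: measurable_xsection.
  by congr (P2 _); apply/seteqP; split => y /=; rewrite !xsectionE.
rewrite -(ge0_integral_pushforward mf1)//=; last exact: measurable_fun_xsection.
by apply: eq_measure_integral => // A mA _; exact: law1.
Qed.

End product_laws.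

Section joint_law.
Context {R : realType} {d e1 e2 : measure_display} {T : measurableType d}.
Context {E1 : measurableType e1} {E2 : measurableType e2}.
Local Open Scope ereal_scope.

(** A measure on the product is determined by its values on measurable rectangles. *)
Lemma indep_joint_law (P : probability T R) (Q1 : probability E1 R)
    (Q2 : probability E2 R) (f1 : T -> E1) (f2 : T -> E2) :
  measurable_fun setT f1 -> measurable_fun setT f2 ->
  (forall A B, measurable A -> measurable B ->
     P (f1 @^-1` A `&` f2 @^-1` B) = Q1 A * Q2 B) ->
  forall S, measurable S -> P ((fun t => (f1 t, f2 t)) @^-1` S) = (Q1 \x Q2) S.
Proof.
move=> mf1 mf2 law12 S mS.
have mf : measurable_fun setT (fun t => (f1 t, f2 t)) by exact: measurable_fun_pair.
pose f : {mfun T >-> (E1 * E2)%type} := HB.pack (fun t => (f1 t, f2 t))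
  (isMeasurableFun.Build _ _ _ _ _ mf).
by apply/esym/(@product_measure_unique _ _ _ _ _ Q1 Q2 (pushforward P f)).
Qed.

End joint_law.

(** * Convolution of possibly degenerate normal laws *)

Section normal_law_convolution.
Context {R : realType}.
Local Notation mR := (measurableTypeR R).
Implicit Types (m v : R) (B : set mR).

Lemma dirac_convolutionl m (Q : probability mR R) B : measurable B ->
  (@dirac _ mR m R \x Q)%E ((fun wx : mR * mR => wx.1 + wx.2 : mR) @^-1` B) =
  Q ((fun x : mR => x + m : mR) @^-1` B).
Proof.
move=> mB; have mS := measurable_add_preimage _ mB.
rewrite /product_measure1 integral_dirac//; last exact: measurable_fun_xsection.
by rewrite diracT mul1e/= xsection_add_preimage.
Qed.

Lemma dirac_convolutionr m (Q : probability mR R) B : measurable B ->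
  (Q \x @dirac _ mR m R)%E ((fun wx : mR * mR => wx.1 + wx.2 : mR) @^-1` B) =
  Q ((fun x : mR => x + m : mR) @^-1` B).
Proof.
move=> mB; have mS : measurable ((fun x : mR => x + m : mR) @^-1` B).
  by rewrite -[X in measurable X]setTI; exact: measurable_addr.
rewrite /product_measure1 -[X in Q X]setIT -integral_indic//.
apply: eq_integral => w _; rewrite /= xsection_add_preimage diracE indicE.
by congr ((nat_of_bool _)%:R%:E); apply/idP/idP; rewrite !inE/= addrC.
Qed.

Lemma normal_law_dirac m B : normal_law m 0 B = \d_m B.
Proof. by rewrite /normal_law eqxx. Qed.

Lemma normal_law_normal_prob m v B : v != 0 ->
  normal_law m v B = normal_prob m (Num.sqrt v) B.
Proof. by rewrite /normal_law => /negPf ->. Qed.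

Lemma normal_law_shift m c v B : 0 <= v -> measurable B ->
  normal_law m v ((fun x : mR => x + c : mR) @^-1` B) = normal_law (m + c) v B.
Proof.
rewrite le0r => /orP[/eqP -> mB|v0 mB]; first by rewrite !normal_law_dirac.
have vN0 : v != 0 by rewrite gt_eqF.
have sN0 : Num.sqrt v != 0 by rewrite gt_eqF ?sqrtr_gt0.
by rewrite (normal_law_normal_prob _ _ _ vN0) (normal_law_normal_prob _ _ _ vN0) normal_prob_shift.
Qed.

(** Since [normal_law] is a bare set function, probability measures [Q1] and [Q2] agreeing with it
    on measurable sets carry the product. A zero variance makes one factor a Dirac mass, hence a
    translation; otherwise densities are convolved. *)
Lemma normal_law_convolution (Q1 Q2 : probability mR R) m1 m2 v1 v2 B :
  0 <= v1 -> 0 <= v2 ->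
  (forall A, measurable A -> Q1 A = normal_law m1 v1 A) ->
  (forall A, measurable A -> Q2 A = normal_law m2 v2 A) -> measurable B ->
  (Q1 \x Q2)%E ((fun wx : mR * mR => wx.1 + wx.2 : mR) @^-1` B) =
  normal_law (m1 + m2) (v1 + v2) B.
Proof.
move=> v1ge0 v2ge0 Q1E Q2E mB; have mS := measurable_add_preimage _ mB.
have mBc c : measurable ((fun x : mR => x + c : mR) @^-1` B).
  by rewrite -[X in measurable X]setTI; exact: measurable_addr.
(* Transport along identity maps allows each factor to be replaced by a concrete measure with the
   same values on measurable sets. *)
have prodE (Q1' Q2' : probability mR R) :
    (forall A, measurable A -> Q1 A = Q1' A) ->
    (forall A, measurable A -> Q2 A = Q2' A) ->
    (Q1 \x Q2)%E ((fun wx : mR * mR => wx.1 + wx.2 : mR) @^-1` B) =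
    (Q1' \x Q2')%E ((fun wx : mR * mR => wx.1 + wx.2 : mR) @^-1` B).
  move=> eQ1 eQ2.
  have mid : measurable_fun setT (idfun : mR -> mR) by exact: measurable_id.
  exact: (product_measure1_law Q1 Q2 Q1' Q2' idfun idfun mid eQ1 eQ2 _ mS).

have [v10|v1N0] := eqVneq v1 0.
  rewrite (prodE (@dirac _ mR m1 R) Q2)//; last first.
    by move=> A mA; rewrite Q1E// v10 normal_law_dirac.
  rewrite (dirac_convolutionl _ _ _ mB) (Q2E _ (mBc m1)) v10 add0r (addrC m1).
  exact: normal_law_shift.
have [v20|v2N0] := eqVneq v2 0.
  rewrite (prodE Q1 (@dirac _ mR m2 R))//; last first.
    by move=> A mA; rewrite Q2E// v20 normal_law_dirac.
  rewrite (dirac_convolutionr _ _ _ mB) (Q1E _ (mBc m2)) v20 addr0.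
  exact: normal_law_shift.
rewrite (prodE (normal_prob m1 (Num.sqrt v1)) (normal_prob m2 (Num.sqrt v2))).
- have v10 : 0 < v1 by rewrite lt0r v1N0.
  have v20 : 0 < v2 by rewrite lt0r v2N0.
  have v0 : 0 < v1 + v2 by rewrite addr_gt0.
  (* The means are swapped because [normal_convolution] puts its second mean on the first factor. *)
  rewrite (@normal_convolution _ m2 m1 _ _ (Num.sqrt (v1 + v2)) _ _ _ _ _ mB).
  + by rewrite normal_law_normal_prob ?gt_eqF// addrC.
  + by rewrite gt_eqF ?sqrtr_gt0.
  + by rewrite gt_eqF ?sqrtr_gt0.
  + by rewrite gt_eqF ?sqrtr_gt0.
  + by rewrite !sqr_sqrtr ?ltW// addrC.
- by move=> A mA; rewrite Q1E// normal_law_normal_prob.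
- by move=> A mA; rewrite Q2E// normal_law_normal_prob.
Qed.

End normal_law_convolution.

(** * Laws and measurability of random vectors *)

Section law_of.
Context {R : realType} {d e : measure_display}.
Context {T : measurableType d} {E : measurableType e}.

Lemma law_of (P : probability T R) (f : T -> E) : measurable_fun setT f ->
  {Q : probability E R | forall A, P (f @^-1` A) = Q A}.
Proof.
move=> mf.
pose f' : {mfun T >-> E} := HB.pack f (isMeasurableFun.Build _ _ _ _ _ mf).
by exists (distribution P f').
Qed.

End law_of.

Section random_vectors.
Context {R : realType}.

(* An alias, so that it carries the sigma-algebra [vec_measurable] and no other. *)
Definition vecT (p : nat) : Type := 'cV[R]_p.

HB.instance Definition _ p := Choice.on (vecT p).
HB.instance Definition _ p := isPointed.Build (vecT p) (0 : 'cV[R]_p).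
HB.instance Definition _ p := @isMeasurable.Build default_measure_display
  (vecT p) (@vec_measurable R p) (@sigma_algebra0 _ setT _)
  (@sigma_algebraC _ _) (@sigma_algebra_bigcup _ setT _).

Context {d : measure_display} {T : measurableType d} {p : nat}.

Lemma measurable_coord (i : 'I_p) : measurable_fun setT (fun x : vecT p => x i 0).
Proof.
move=> _ B mB; rewrite setTI; apply: sub_sigma_algebra.
by exists i, B.
Qed.

(** Measurability need only be tested on the generators of the sigma-algebra, which are coordinate
    preimages. *)
Lemma random_vec_measurable (X : T -> 'cV[R]_p) :
  random_vec X -> measurable_fun setT (X : T -> vecT p).
Proof.
move=> rX.
apply: (@measurability _ _ T (vecT p) setT X
  [set A | exists (i : 'I_p) (B : set R),
     measurable B /\ A = (fun x : 'cV[R]_p => x i 0) @^-1` B]) => //.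
move=> _ [_ [i [B [mB ->]]] <-]; exact: rX.
Qed.

Lemma random_vecD (X Y : T -> 'cV[R]_p) :
  random_vec X -> random_vec Y -> random_vec (fun t => X t + Y t).
Proof.
move=> rX rY i; rewrite (_ : (fun t => _) = (fun t => X t i 0 + Y t i 0)).
  exact: measurable_funD.
by apply/funext => t; rewrite mxE.
Qed.

Lemma random_vec_cst (c : 'cV[R]_p) : random_vec (fun _ : T => c).
Proof. by move=> i; exact: measurable_cst. Qed.

Lemma random_vecZ (U : T -> R) (c : 'cV[R]_p) : measurable_fun setT U ->
  random_vec (fun t => U t *: c).
Proof.
move=> mU i; rewrite (_ : (fun t => _) = (fun t => U t * c i 0)).
  by apply: measurable_funM => //; exact: measurable_cst.
by apply/funext => t; rewrite mxE.
Qed.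

Lemma random_vecM q (M : 'M[R]_(q, p)) (X : T -> 'cV[R]_p) :
  random_vec X -> random_vec (fun t => M *m X t).
Proof.
move=> rX i.
rewrite (_ : (fun t => _) = (fun t => \sum_j (M i j * X t j 0))); last first.
  by apply/funext => t; rewrite mxE.
apply: measurable_sum => j; apply: measurable_funM => //; exact: measurable_cst.
Qed.

End random_vectors.

Lemma random_vec_comp {R : realType} {d d' : measure_display} {T : measurableType d}
  {T' : measurableType d'} {p : nat} (X : T' -> 'cV[R]_p) (f : T -> T') :
  measurable_fun setT f -> random_vec X -> random_vec (fun t => X (f t)).
Proof. by move=> mf rX i; exact: (measurableT_comp (rX i)). Qed.

Lemma random_vec_id {R : realType} {p : nat} :
  random_vec (fun x : @vecT R p => x : 'cV[R]_p).
Proof. by move=> i; exact: measurable_coord. Qed.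

(** * Sums, independence and normality on the product space *)

Section MMN_add.
Context {R : realType} {d d' : measure_display}.
Context {T : measurableType d} {T' : measurableType d'}.
Context (P : probability T R) (P' : probability T' R) {p : nat}.
Local Open Scope ereal_scope.

Lemma normal_lawD (X : T -> R) (X' : T' -> R) (m m' v v' : R) :
  (0 <= v)%R -> (0 <= v')%R -> measurable_fun setT X -> measurable_fun setT X' ->
  (forall B : set R, measurable B -> P (X @^-1` B) = normal_law m v B) ->
  (forall B : set R, measurable B -> P' (X' @^-1` B) = normal_law m' v' B) ->
  forall B : set R, measurable B ->
    (P \x P') ((fun t => (X t.1 + X' t.2)%R) @^-1` B) =
    normal_law (m + m') (v + v') B.
Proof.
move=> v0 v'0 mX mX' law law' B mB.
have [Q QE] := @law_of _ _ _ _ (measurableTypeR R) P X mX.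
have [Q' Q'E] := @law_of _ _ _ _ (measurableTypeR R) P' X' mX'.
rewrite -(@normal_law_convolution _ Q Q' _ _ _ _ _ v0 v'0 _ _ mB).
- have mS := measurable_add_preimage _ mB.
  exact: (@product_measure1_law _ _ _ _ _ _ _ _ _ P P' Q Q' X X' mX
    (fun A _ => QE A) (fun A _ => Q'E A) _ mS).
- by move=> A mA; rewrite -QE; exact: law.
- by move=> A mA; rewrite -Q'E; exact: law'.
Qed.

(** By Fubini: for each fixed first coordinate the second variable is a measurable function of [Z]
    alone, so independence of [U] and [Z] factors every section, and the constant factor leaves the
    integral. *)
Lemma indep_product_snd (U : T' -> R) (Z : T' -> 'cV[R]_p)
    (Y : T -> 'cV[R]_p) (M : 'M[R]_p) :
  measurable_fun setT U -> random_vec Z -> random_vec Y -> indep_rv_vec P' U Z ->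
  indep_rv_vec (P \x P') (fun t => U t.2) (fun t => M *m Z t.2 + Y t.1)%R.
Proof.
move=> mU rZ rY indep B A mB mA.
have mUB : measurable (U @^-1` B) by rewrite -[X in measurable X]setTI; exact: mU.
have rX : random_vec (fun t : T * T' => M *m Z t.2 + Y t.1)%R.
  apply: random_vecD.
    by apply: random_vecM; exact: (random_vec_comp Z _ measurable_snd rZ).
  exact: (random_vec_comp Y _ measurable_fst rY).
have mS : measurable ((fun t : T * T' => M *m Z t.2 + Y t.1)%R @^-1` A).
  by rewrite -[X in measurable X]setTI; exact: (random_vec_measurable _ rX).
rewrite [X in _ = X * _](_ : _ = P' (U @^-1` B)); last first.
  rewrite (_ : _ @^-1` _ = setT `*` (U @^-1` B)); last first.
    by apply/seteqP; split => // t [].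
  rewrite [LHS](product_measure1E P P' measurableT mUB).
  by rewrite -[RHS]mul1e; congr (_ * _); exact: probability_setT.
rewrite /product_measure1 -ge0_integralZl//; last exact: measurable_fun_xsection.
apply: eq_integral => t _ /=.
(* With [t] frozen, the event on the vector becomes a measurable event on [Z], to which [indep]
   applies. *)
have mAt : vec_measurable ((fun z : 'cV[R]_p => M *m z + Y t)%R @^-1` A).
  have rt : random_vec (fun z : @vecT R p => M *m (z : 'cV[R]_p) + Y t)%R.
    by apply: random_vecD; [apply: random_vecM; exact: random_vec_id|exact: random_vec_cst].
  by have := random_vec_measurable _ rt measurableT _ mA; rewrite setTI.
transitivity (P' (U @^-1` B `&` Z @^-1` ((fun z : 'cV[R]_p => M *m z + Y t)%R @^-1` A))).
  by congr (P' _); apply/seteqP; split => y /=; rewrite xsectionE.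
rewrite indep//; congr (_ * P' _).
by apply/seteqP; split => y /=; rewrite xsectionE.
Qed.

(** Both sums are the same function of a pair with law [Q2 \x Q1]: on the left by independence, on
    the right by construction of the product space. *)
Lemma same_law_add (Y1 Y2 : T -> 'cV[R]_p) (V : T' -> 'cV[R]_p) :
  random_vec Y1 -> random_vec Y2 -> random_vec V -> indep_vec P Y1 Y2 ->
  same_law P P' Y1 V ->
  same_law P (P \x P') (fun t => Y1 t + Y2 t)%R (fun t => V t.2 + Y2 t.1)%R.
Proof.
move=> rY1 rY2 rV indep law A mA.
have mY1 := random_vec_measurable _ rY1.
have mY2 := random_vec_measurable _ rY2.
have [Q1 Q1E] := law_of P _ mY1; have [Q2 Q2E] := law_of P _ mY2.
(* The pair is ordered with [Y2] first, since [Y2] lives on the first factor of [T * T']. *)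
pose S : set (@vecT R p * @vecT R p) := [set y | A (y.2 + y.1)%R].
have mS : measurable S.
  have radd : random_vec (fun y : @vecT R p * @vecT R p => (y.2 : 'cV[R]_p) + y.1)%R.
    apply: random_vecD.
      exact: (random_vec_comp _ _ measurable_snd random_vec_id).
    exact: (random_vec_comp _ _ measurable_fst random_vec_id).
  by have := random_vec_measurable _ radd measurableT _ mA; rewrite setTI.
transitivity ((Q2 \x Q1) S).
  apply: (@indep_joint_law _ _ _ _ _ _ _ P Q2 Q1 Y2 Y1) => // A1 A2 mA1 mA2.
  by rewrite setIC indep// Q1E Q2E muleC.
apply/esym; apply: (@product_measure1_law _ _ _ _ _ _ _ _ _ P P' Q2 Q1 Y2 V) => //.
by move=> A1 mA1; rewrite -Q1E law.
Qed.

End MMN_add.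

(** Pairing with [a] gives [b^T *m Y + c^T *m Z] minus a constant, where [b = N^T *m a] and
    [c = M^T *m a]. The two terms depend on different coordinates, so their normal laws convolve:
    means add, and the variances are the forms of [S] at [b] and [A] at [c]. *)
Lemma is_normal_product_add {R : realType} {d d' : measure_display}
    {T : measurableType d} {T' : measurableType d'} {P : probability T R}
    {P' : probability T' R} {p : nat} {Y : T -> 'cV[R]_p} {Z : T' -> 'cV[R]_p}
    {mu nu : 'cV[R]_p} {S A : 'M[R]_p} (M N : 'M[R]_p) :
  covariance_mx S -> covariance_mx A ->
  is_normal P Y mu S -> is_normal P' Z nu A ->
  is_normal (P \x P')%E (fun t => M *m Z t.2 + N *m (Y t.1 - mu)) (M *m nu)
    (M *m A *m M^T + N *m S *m N^T).
Proof.
move=> [_ covS] [_ covA] [rY lawY] [rZ lawZ]; split.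
  apply: random_vecD.
    by apply: random_vecM; exact: (random_vec_comp Z _ measurable_snd rZ).
  apply: random_vecM; apply: random_vecD; last exact: random_vec_cst.
  exact: (random_vec_comp Y _ measurable_fst rY).
move=> a B mB.
pose b := N^T *m a; pose c := M^T *m a.
have mX (e : measure_display) (E : measurableType e) (X : E -> 'cV[R]_p) (x : 'cV[R]_p) :
    random_vec X -> measurable_fun setT (fun t => (x^T *m X t) 0 0).
  by move=> rX; exact: (random_vecM _ x^T _ rX 0).
(* The constant produced by centring [Y]; it is absorbed by translating [B] and later cancels the
   contribution of [mu] to the mean. *)
pose k := (b^T *m mu) 0 0.
have mBk : measurable ((fun x : measurableTypeR R => x - k : measurableTypeR R) @^-1` B).
  by rewrite -[X in measurable X]setTI; exact: measurable_addr.
transitivity ((P \x P')%E ((fun t => (b^T *m Y t.1) 0 0 + (c^T *m Z t.2) 0 0) @^-1`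
    ((fun x : measurableTypeR R => x - k : measurableTypeR R) @^-1` B))).
  congr ((P \x P')%E _); apply/funext => t; rewrite /preimage/=; congr B.
  rewrite /k /b /c !trmx_mul !trmxK mulmxDr !mulmxBr !mulmxA.
  by rewrite mxE [X in _ + X]mxE [X in _ + (_ + X)]mxE; ring.
have vge0 := addr_ge0 (covS b) (covA c).
rewrite [LHS](normal_lawD P P' _ _ _ _ _ _ (covS b) (covA c) (mX _ _ _ _ rY)
  (mX _ _ _ _ rZ) (lawY b) (lawZ c) _ mBk).
rewrite (normal_law_shift _ _ _ _ vge0 mB); congr (normal_law _ _ B).
  by rewrite /k addrAC subrr add0r /c trmx_mul trmxK !mulmxA.
by rewrite mulmxDr mulmxDl [RHS]mxE addrC /b /c !trmx_mul !trmxK !mulmxA.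
Qed.

Theorem theorem2 (R : realType) (d : measure_display) (T : measurableType d)
  (P : probability T R) (p : nat) (p_gt0 : (0 < p)%N)
  (xi : 'cV[R]_p) (Om : 'M[R]_p) (delta : 'cV[R]_p) (H : R -> R)
  (mu : 'cV[R]_p) (Sigma : 'M[R]_p)
  (Y1 Y2 : T -> 'cV[R]_p) :
  sym_posdef Om ->
  sym_posdef (Omega_bar Om - delta *m delta^T) ->
  covariance_mx Sigma ->
  is_MMN P Y1 xi Om delta H ->
  is_normal P Y2 mu Sigma ->
  indep_vec P Y1 Y2 ->
  is_MMN P (fun t => Y1 t + Y2 t) (xi + mu) (Om + Sigma)
    (invmx (omega_of (Om + Sigma)) *m omega_of Om *m delta) H.
Proof.
move=> posOm posB covS [_ _ rY1 [d' [T' [P' [U [Z [cdfU normZ indUZ lawY1]]]]]]].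
move=> normY2 indY.
have [mU UH] := cdfU; have [rZ _] := normZ; have [rY2 _] := normY2.
have posD := sym_posdefD_cov _ _ posOm covS.
have uW := omega_of_unit _ posD.
set W := omega_of (Om + Sigma) in uW *; set w := omega_of Om.
set B := Omega_bar Om - delta *m delta^T in posB normZ.
split => //.
- exact: sym_posdef_MMN_add.
- exact: random_vecD.
(* Multiplied by [W], the new vector is [w *m Z + (Y2 - mu)]. Centring [Y2] gives mean zero and
   leaves [mu] to the location parameter. *)
exists _, (T * T')%type, (P \x P')%E, (fun t => U t.2),
  (fun t => (invmx W *m w) *m Z t.2 + invmx W *m (Y2 t.1 - mu)); split.
- split; first exact: (measurableT_comp mU measurable_snd).
  (* The event depends on the second coordinate only, so it is a rectangle with a full first side of
     probability 1. *)
  move=> x; rewrite -UH (_ : _ @^-1` _ = setT `*` (U @^-1` `]-oo, x])); last first.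
    by apply/seteqP; split => // t [].
  have mUx : measurable (U @^-1` `]-oo, x]).
    by rewrite -[X in measurable X]setTI; exact: mU.
  rewrite [LHS](product_measure1E P P' measurableT mUx).
  by rewrite -[RHS]mul1e; congr (_ * _)%E; exact: probability_setT.
- have covB : covariance_mx B.
    by split; [case: posB|move=> x; exact: sym_posdef_psd].
  have := is_normal_product_add (invmx W *m w) (invmx W) covS covB normY2 normZ.
  rewrite mulmx0 => normD.
  (* The covariance obtained from the two independent terms is the one prescribed for the sum, by
     expanding the congruence in [Omega_barD_sub]. *)
  have <- : invmx W *m w *m B *m (invmx W *m w)^T + invmx W *m Sigma *m (invmx W)^T =
      Omega_bar (Om + Sigma) -
      (invmx W *m w *m delta) *m (invmx W *m w *m delta)^T; last exact: normD.
  rewrite (Omega_barD_sub _ _ delta posOm covS) -/W -/w -/B.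
  rewrite trmx_mul trmx_inv !tr_omega_of -/W -/w.
  by rewrite (mulmxDr (invmx W) (w *m B *m w)) [in RHS]mulmxDl !mulmxA.
- apply: (indep_product_snd P P' U Z (fun t => invmx W *m (Y2 t - mu)) (invmx W *m w)) => //.
  by apply: random_vecM; apply: random_vecD => //; exact: random_vec_cst.
- have rV : random_vec (fun t => xi + w *m (U t *: delta + Z t)).
    apply: random_vecD; first exact: random_vec_cst.
    apply: random_vecM; apply: random_vecD => //; exact: random_vecZ.
  have lawY := same_law_add P P' Y1 Y2 _ rY1 rY2 rV indY lawY1.
  move=> A mA; rewrite lawY//; congr ((P \x P')%E _).
  (* It remains to check pointwise that [W] cancels its inverse and [mu] cancels, leaving the
     representation of [Y1] plus [Y2]. *)
  apply/funext => t; rewrite /preimage/=; congr A.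
  rewrite scalemxAr -!(mulmxA (invmx W)) -!mulmxDr (mulKVmx uW) (addrA (w *m _)) -mulmxDr.
  by rewrite addrACA (addrC mu) subrK.
Qed.
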